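(* Let $\mathcal{C}$ be a category, and let $\mathbb{G}$ and $\mathbb{K}$ be two comonads on $\mathcal{C}$ which generate the same projective class $\mathcal{P}$, and suppose that $\mathcal{P}$ is a Kan projective class on $\mathcal{C}$. Let $E\colon \mathcal{C}\to\mathcal{A}$ be a functor into a semi-abelian category $\mathcal{A}$. Then for all $n\geq 1$ the functors $\mathrm{H}_n(-,E)_{\mathbb{G}}$ and $\mathrm{H}_n(-,E)_{\mathbb{K}}$ from $\mathcal{C}$ to $\mathcal{A}$ are (naturally) isomorphic.
   Context: Projective classes. For an object $P$ and a morphism $e\colon X\to Y$ of $\mathcal{C}$, say that $P$ is $e$-projective and $e$ is $P$-epic if $e\circ(\cdot)\colon \mathrm{Hom}(P,X)\to\mathrm{Hom}(P,Y)$ is surjective. A projective class on $\mathcal{C}$ is a pair $(\mathcal{P},\mathcal{E})$, with $\mathcal{P}$ a class of objects and $\mathcal{E}$ a class of morphisms, such that $\mathcal{P}$ is the class of all objects that are $e$-projective for every $e\in\mathcal{E}$, $\mathcal{E}$ is the class of all morphisms that are $P$-epic for every $P\in\mathcal{P}$, and for every object $Y$ there is a morphism $P\to Y$ in $\mathcal{E}$ with $P\in\mathcal{P}$. Since $\mathcal{P}$ determines $\mathcal{E}$, one speaks of ''the projective class $\mathcal{P}$''. The projective class generated by a comonad $\mathbb{G}=(G,\delta\colon G\Rightarrow G^2,\epsilon\colon G\Rightarrow 1_{\mathcal{C}})$ on $\mathcal{C}$ is the one generated by the objects $GY$: $\mathcal{E}_{\mathbb{G}}$ is the class of morphisms that are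 $GY$-epic for all objects $Y$, and $\mathcal{P}_{\mathbb{G}}$ is the class of objects $e$-projective for all $e\in\mathcal{E}_{\mathbb{G}}$ (equivalently, the objects $X$ admitting $s\colon X\to GX$ with $\epsilon_X s=1_X$). Kan and contractible. A simplicial set $S$ is Kan if for all $n\geq 1$ and $0\leq k\leq n$, every family $(s_i)_{0\leq i\leq n,\,i\neq k}$ in $S_{n-1}$ with $\partial_i(s_j)=\partial_{j-1}(s_i)$ for all $i<j$, $i,j\neq k$, has a filler $s\in S_n$ with $\partial_i(s)=s_i$ for all $i\neq k$; an augmented simplicial set is Kan if the underlying simplicial set (degrees $\geq 0$) is. An augmented simplicial object $A=(A_n)_{n\geq -1}$ is contractible if there are maps $h_n\colon A_n\to A_{n+1}$, $n\geq -1$, with $\partial_0h_n=1_{A_n}$ and $\partial_ih_n=h_{n-1}\partial_{i-1}$ for $i>0$. Given a projective class $\mathcal{P}$ on $\mathcal{C}$, an augmented simplicial object $A$ in $\mathcal{C}$ is relatively contractible if the augmented simplicial set $\mathrm{Hom}(P,A)$ is contractible for every $P\in\mathcal{P}$, and Kan relative to $\mathcal{P}$ if $\mathrm{Hom}(P,A)$ is Kan for every $P\in\mathcal{P}$. $\mathcal{P}$ is called a Kan projective class on $\mathcal{C}$ if every relatively contractible augmented simplicial object in $\mathcal{C}$ is Kan relative to $\mathcal{P}$. Semi-abelian categories and homology. A semi-abelian category is a category which is pointed, Barr exact (regular, with every equivalence relation a kernel pair), Bourn protomodular (the regular Short Five Lemma holds) and has binary coproducts. For a simplicial object $A$ in a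 semi-abelian category, the Moore complex $\mathrm{N}(A)$ has $\mathrm{N}_0A=A_0$, $\mathrm{N}_nA=\bigcap_{i=0}^{n-1}\mathrm{Ker}[\partial_i\colon A_n\to A_{n-1}]$ for $n\geq 1$, $\mathrm{N}_nA=0$ for $n<0$, and $d_n\colon \mathrm{N}_nA\to \mathrm{N}_{n-1}A$ the restriction of $\partial_n$. The homology object $\mathrm{H}_n\mathrm{N}(A)$ is the cokernel of the factorisation $d'_{n+1}\colon \mathrm{N}_{n+1}A\to \mathrm{Ker}[d_n]$ of $d_{n+1}$ over the kernel of $d_n$. Comonadic homology. For an object $X$ of $\mathcal{C}$, $\mathbb{G}X$ is the simplicial object (augmented over $X$ by $\epsilon_X$) with $G^{n+1}X$ in degree $n$, faces $\partial_i=G^i\epsilon_{G^{n-i}X}\colon G^{n+1}X\to G^nX$ and degeneracies $\sigma_i=G^i\delta_{G^{n-i}X}\colon G^{n+1}X\to G^{n+2}X$. For $n\geq 1$, $\mathrm{H}_n(X,E)_{\mathbb{G}}=\mathrm{H}_{n-1}\mathrm{N}(E\mathbb{G}X)$, where $E\mathbb{G}X$ is the simplicial object obtained by applying $E$ in degrees $\geq 0$; this is a functor of $X$. *)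

(* Defs.v *)
From mathcomp Require Import all_boot zify.
From Stdlib Require Import FunctionalExtensionality ClassicalEpsilon.

Set Implicit Arguments.
Unset Strict Implicit.
Unset Printing Implicit Defensive.

Declare Scope cat_scope.
Delimit Scope cat_scope with cat.
Local Open Scope cat_scope.

Record category := Category {
  obj :> Type;
  hom : obj -> obj -> Type;
  idm : forall X, hom X X;
  comp : forall X Y Z, hom Y Z -> hom X Y -> hom X Z;
  compA : forall X Y Z T (h : hom Z T) (g : hom Y Z) (f : hom X Y),
    comp h (comp g f) = comp (comp h g) f;
  comp1m : forall X Y (f : hom X Y), comp (idm Y) f = f;
  compm1 : forall X Y (f : hom X Y), comp f (idm X) = f }.

Arguments hom {c} X Y.
Arguments idm {c} X.
Arguments comp {c X Y Z} g f.

Notation "g ∘ f" := (comp g f) (at level 40, left associativity) : cat_scope.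

Definition is_iso (C : category) (X Y : C) (f : hom X Y) : Prop :=
  exists g : hom Y X, g ∘ f = idm X /\ f ∘ g = idm Y.

Record functor (C D : category) := Functor {
  fobj :> C -> D;
  fmap : forall X Y : C, hom X Y -> hom (fobj X) (fobj Y);
  fmap1 : forall X, fmap (idm X) = idm (fobj X);
  fmapM : forall X Y Z (g : hom Y Z) (f : hom X Y),
    fmap (g ∘ f) = fmap g ∘ fmap f }.

Arguments fmap {C D} F {X Y} f : rename.

Lemma fmap_square (C D : category) (F : functor C D) (X Y Y' Z : C)
    (g : hom Y Z) (f : hom X Y) (g' : hom Y' Z) (f' : hom X Y') :
  g ∘ f = g' ∘ f' -> fmap F g ∘ fmap F f = fmap F g' ∘ fmap F f'.
Proof. by rewrite -!fmapM => ->. Qed.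

Definition idF (C : category) : functor C C :=
  @Functor C C (fun X => X) (fun X Y f => f)
    (fun X => erefl) (fun X Y Z g f => erefl).

Lemma compF_fmap1 (B C D : category) (F : functor C D) (G : functor B C) X :
  fmap F (fmap G (idm X)) = idm (F (G X)).
Proof. by rewrite !fmap1. Qed.

Lemma compF_fmapM (B C D : category) (F : functor C D) (G : functor B C)
    X Y Z (g : hom Y Z) (f : hom X Y) :
  fmap F (fmap G (g ∘ f)) = fmap F (fmap G g) ∘ fmap F (fmap G f).
Proof. by rewrite !fmapM. Qed.

Definition compF (B C D : category) (F : functor C D) (G : functor B C) :
    functor B D :=
  @Functor B D (fun X => F (G X)) (fun X Y f => fmap F (fmap G f))
    (compF_fmap1 F G) (@compF_fmapM _ _ _ F G).

Record nat_trans (C D : category) (F G : functor C D) := NatTrans {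
  ntc :> forall X : C, hom (F X) (G X);
  natural : forall (X Y : C) (f : hom X Y),
    ntc Y ∘ fmap F f = fmap G f ∘ ntc X }.

Definition naturally_isomorphic (C D : category) (F G : functor C D) : Prop :=
  exists t : nat_trans F G, forall X, is_iso (t X).

Record comonad (C : category) := Comonad {
  cfun :> functor C C;
  comult : nat_trans cfun (compF cfun cfun);
  counit : nat_trans cfun (idF C);
  counitl : forall X, counit (cfun X) ∘ comult X = idm (cfun X);
  counitr : forall X, fmap cfun (counit X) ∘ comult X = idm (cfun X);
  comultA : forall X,
    comult (cfun X) ∘ comult X = fmap cfun (comult X) ∘ comult X }.

(* Faces and degeneracies carry a natural number index: [face n i] is
   meaningful for [i <= n.+1] and [degen n i] for [i <= n]; the values outside
   these ranges are never used. *)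
Record simplicial (C : category) := Simplicial {
  sob :> nat -> C;
  face : forall n : nat, nat -> hom (sob n.+1) (sob n);
  degen : forall n : nat, nat -> hom (sob n) (sob n.+1);
  face_face : forall n i j, i < j <= n.+2 ->
    face n i ∘ face n.+1 j = face n j.-1 ∘ face n.+1 i;
  degen_degen : forall n i j, i <= j <= n ->
    degen n.+1 i ∘ degen n j = degen n.+1 j.+1 ∘ degen n i;
  face_degen_lt : forall n i j, i < j <= n.+1 ->
    face n.+1 i ∘ degen n.+1 j = degen n j.-1 ∘ face n i;
  face_degen_eq : forall n i, i <= n -> face n i ∘ degen n i = idm (sob n);
  face_degen_eqS : forall n i, i <= n ->
    face n i.+1 ∘ degen n i = idm (sob n);
  face_degen_gt : forall n i j, j.+1 < i <= n.+2 ->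
    face n.+1 i ∘ degen n.+1 j = degen n j ∘ face n i.-1 }.

Arguments face {C} s n i : rename.
Arguments degen {C} s n i : rename.

Record smor (C : category) (S T : simplicial C) := Smor {
  smc :> forall n, hom (S n) (T n);
  smor_face : forall n i, i <= n.+1 ->
    smc n ∘ face S n i = face T n i ∘ smc n.+1;
  smor_degen : forall n i, i <= n ->
    smc n.+1 ∘ degen S n i = degen T n i ∘ smc n }.

Lemma smor_ext (C : category) (S T : simplicial C) (s t : smor S T) :
  (forall n, s n = t n) -> s = t.
Proof.
case: s t => s sf sd [t tf td] /= est.
have e : s = t by apply: functional_extensionality_dep.
by subst t; f_equal; apply: proof_irrelevance.
Qed.

Definition smor_id (C : category) (S : simplicial C) : smor S S.
Proof. by exists (fun n => idm (S n)) => n i _; rewrite comp1m compm1. Defined.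

Definition smor_comp (C : category) (S T U : simplicial C)
  (t : smor T U) (s : smor S T) : smor S U.
Proof.
exists (fun n => t n ∘ s n) => n i le_i.
  by rewrite -compA smor_face // !compA smor_face.
by rewrite -compA smor_degen // !compA smor_degen.
Defined.

Definition simplicial_category (C : category) : category.
Proof.
apply: (@Category (simplicial C) (@smor C) (@smor_id C) (@smor_comp C)).
- by move=> *; apply: smor_ext => n; apply: compA.
- by move=> *; apply: smor_ext => n; apply: comp1m.
- by move=> *; apply: smor_ext => n; apply: compm1.
Defined.

Definition simplicial_map_obj (C D : category) (F : functor C D)
  (S : simplicial C) : simplicial D.
Proof.
exists (fun n => F (S n)) (fun n i => fmap F (face S n i))
  (fun n i => fmap F (degen S n i)).
- by move=> n i j h; rewrite -!fmapM face_face.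
- by move=> n i j h; rewrite -!fmapM degen_degen.
- by move=> n i j h; rewrite -!fmapM face_degen_lt.
- by move=> n i h; rewrite -!fmapM face_degen_eq // fmap1.
- by move=> n i h; rewrite -!fmapM face_degen_eqS // fmap1.
- by move=> n i j h; rewrite -!fmapM face_degen_gt.
Defined.

Definition simplicial_map_mor (C D : category) (F : functor C D)
  (S T : simplicial C) (s : smor S T) :
  smor (simplicial_map_obj F S) (simplicial_map_obj F T).
Proof.
exists (fun n => fmap F (s n)) => n i h /=; rewrite -!fmapM.
  by rewrite smor_face.
by rewrite smor_degen.
Defined.

Definition simplicial_map (C D : category) (F : functor C D) :
  functor (simplicial_category C) (simplicial_category D).
Proof.
apply: (@Functor (simplicial_category C) (simplicial_category D)
  (simplicial_map_obj F) (@simplicial_map_mor _ _ F)).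
- by move=> S; apply: smor_ext => n; apply: fmap1.
- by move=> S T U t s; apply: smor_ext => n; apply: fmapM.
Defined.

(* The terms of degree at least 0 form [asimp]; the term of degree -1 is
   [abase], and [aug] is the face from degree 0 to degree -1. *)
Record augmented (C : category) := Augmented {
  asimp :> simplicial C;
  abase : C;
  aug : hom (asimp 0) abase;
  aug_face : aug ∘ face asimp 0 0 = aug ∘ face asimp 0 1 }.

Arguments abase {C} a.
Arguments aug {C} a.

Definition augmented_map (C D : category) (F : functor C D)
  (S : augmented C) : augmented D.
Proof.
exists (simplicial_map F S) (F (abase S)) (fmap F (aug S)).
by rewrite /= -!fmapM aug_face.
Defined.

(* [hb] is h_{-1} and [h n] is h_n; the identities for h_{-1} and h_0 involve
   the augmentation and are therefore listed separately. *)
Definition contractible (C : category) (S : augmented C) : Prop :=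
  exists (hb : hom (abase S) (S 0)) (h : forall n, hom (S n) (S n.+1)),
    [/\ aug S ∘ hb = idm (abase S),
        forall n, face S n 0 ∘ h n = idm (S n),
        face S 0 1 ∘ h 0 = hb ∘ aug S &
        forall n i, i <= n.+1 ->
          face S n.+1 i.+1 ∘ h n.+1 = h n ∘ face S n i].

Definition Sets : category :=
  @Category Type (fun X Y => X -> Y) (fun X x => x)
    (fun X Y Z g f x => g (f x))
    (fun _ _ _ _ _ _ _ => erefl) (fun _ _ _ => erefl) (fun _ _ _ => erefl).

Definition sface (S : simplicial Sets) n i : S n.+1 -> S n := face S n i.
Arguments sface {S} n i x.

(* Compatibility of a family [s] of elements of degree m, of which the entry of
   index k is ignored. For m = 0 there is no pair i < j in {0, 1} \ {k}, so
   that the condition is void. *)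
Definition horn_compatible (S : simplicial Sets) (m k : nat) :
    (nat -> S m) -> Prop :=
  match m return (nat -> S m) -> Prop with
  | 0 => fun _ => True
  | p.+1 => fun s => forall i j, i < j <= p.+2 -> i <> k -> j <> k ->
      sface p i (s j) = sface p j.-1 (s i)
  end.

(* The horns of dimension n >= 1 are those with n = m.+1. *)
Definition Kan (S : simplicial Sets) : Prop :=
  forall (m k : nat), k <= m.+1 ->
  forall s : nat -> S m, horn_compatible k s ->
  exists x : S m.+1, forall i, i <= m.+1 -> i <> k -> sface m i x = s i.

Definition hom_functor (C : category) (P : C) : functor C Sets.
Proof.
apply: (@Functor C Sets (fun X => hom P X) (fun X Y f g => f ∘ g)).
- by move=> X; apply: functional_extensionality => g; apply: comp1m.
- by move=> X Y Z g f; apply: functional_extensionality => h;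
     rewrite /= compA.
Defined.

Definition epic_for (C : category) (P X Y : C) (e : hom X Y) : Prop :=
  forall y : hom P Y, exists x : hom P X, e ∘ x = y.

Record projective_class (C : category) := ProjectiveClass {
  pobj : C -> Prop;
  pmor : forall X Y : C, hom X Y -> Prop;
  pobjP : forall P, pobj P <->
    (forall (X Y : C) (e : hom X Y), pmor e -> epic_for P e);
  pmorP : forall (X Y : C) (e : hom X Y), pmor e <->
    (forall P, pobj P -> epic_for P e);
  penough : forall Y, exists (P : C) (e : hom P Y), pobj P /\ pmor e }.

Arguments pobj {C} p P : rename.
Arguments pmor {C} p {X Y} e : rename.

Definition comonad_epic (C : category) (G : comonad C) (X Y : C)
  (e : hom X Y) : Prop := forall Z : C, epic_for (G Z) e.

Definition comonad_projective (C : category) (G : comonad C) (P : C) : Prop :=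
  forall (X Y : C) (e : hom X Y), comonad_epic G e -> epic_for P e.

Definition generates (C : category) (G : comonad C) (P : projective_class C) :
    Prop :=
  (forall X, pobj P X <-> comonad_projective G X) /\
  (forall (X Y : C) (e : hom X Y), pmor P e <-> comonad_epic G e).

Definition relatively_contractible (C : category) (P : projective_class C)
    (S : augmented C) : Prop :=
  forall X, pobj P X -> contractible (augmented_map (hom_functor X) S).

Definition relatively_Kan (C : category) (P : projective_class C)
    (S : augmented C) : Prop :=
  forall X, pobj P X -> Kan (augmented_map (hom_functor X) S).

Definition Kan_projective_class (C : category) (P : projective_class C) :
    Prop :=
  forall S : augmented C, relatively_contractible P S -> relatively_Kan P S.

(* [cpow G n X] is G^n X, with G^{n+1} X = G (G^n X) by conversion. *)
Fixpoint cpow (C : category) (G : functor C C) (n : nat) (X : C) : C :=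
  if n is m.+1 then G (cpow G m X) else X.

(* G^i epsilon_{G^{n-i} X} for i <= n, by recursion on i; the last branch is
   out of range. *)
Fixpoint cface (C : category) (G : comonad C) (X : C) (n i : nat) :
    hom (cpow G n.+1 X) (cpow G n X) :=
  match n, i return hom (cpow G n.+1 X) (cpow G n X) with
  | n, 0 => counit G (cpow G n X)
  | m.+1, j.+1 => fmap G (cface G X m j)
  | 0, _.+1 => counit G X
  end.

(* G^i delta_{G^{n-i} X} for i <= n, with the same convention. *)
Fixpoint cdegen (C : category) (G : comonad C) (X : C) (n i : nat) :
    hom (cpow G n.+1 X) (cpow G n.+2 X) :=
  match n, i return hom (cpow G n.+1 X) (cpow G n.+2 X) with
  | n, 0 => comult G (cpow G n X)
  | m.+1, j.+1 => fmap G (cdegen G X m j)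
  | 0, _.+1 => comult G X
  end.

Fixpoint cpow_map (C : category) (G : functor C C) (n : nat) (X Y : C)
    (f : hom X Y) : hom (cpow G n X) (cpow G n Y) :=
  match n return hom (cpow G n X) (cpow G n Y) with
  | 0 => f
  | m.+1 => fmap G (cpow_map G m f)
  end.

Lemma cface0 (C : category) (G : comonad C) X n :
  cface G X n 0 = counit G (cpow G n X).
Proof. by case: n. Qed.

Lemma cdegen0 (C : category) (G : comonad C) X n :
  cdegen G X n 0 = comult G (cpow G n X).
Proof. by case: n. Qed.

Lemma cfaceS (C : category) (G : comonad C) X n i :
  cface G X n.+1 i.+1 = fmap G (cface G X n i).
Proof. by []. Qed.

Lemma cdegenS (C : category) (G : comonad C) X n i :
  cdegen G X n.+1 i.+1 = fmap G (cdegen G X n i).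
Proof. by []. Qed.

Definition resolution_obj (C : category) (G : comonad C) (X : C) :
  simplicial C.
Proof.
exists (fun n => cpow G n.+1 X) (fun n i => cface G X n.+1 i)
  (fun n i => cdegen G X n i).
- move=> n; suff H k i j : i < j <= k.+1 ->
    cface G X k i ∘ cface G X k.+1 j = cface G X k j.-1 ∘ cface G X k.+1 i.
    by move=> i j h; apply: H.
  elim: k i j => [|k IH] [|i] [|j] h; try (exfalso; lia).
  + have -> : j = 0 by lia.
    by rewrite /= (natural (counit G)).
  + by rewrite cfaceS !cface0 (natural (counit G)).
  + case: j h => [|j] h; first by exfalso; lia.
    exact (fmap_square G (IH i j.+1 h)).
- elim=> [|n IH] [|i] [|j] h; try (exfalso; lia).
  + exact: comultA.
  + exact: comultA.
  + by rewrite !cdegenS !cdegen0 (natural (comult G)).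
  + exact (fmap_square G (IH i j h)).
- elim=> [|n IH] [|i] [|j] h; try (exfalso; lia).
  + have -> : j = 0 by lia.
    by rewrite /= (natural (counit G)).
  + by rewrite cdegenS !cface0 (natural (counit G)).
  + case: j h => [|j] h; first by exfalso; lia.
    exact (fmap_square G (IH i j.+1 h)).
- elim=> [|n IH] [|i] h; try (exfalso; lia).
  + exact: counitl.
  + exact: counitl.
  + by rewrite cfaceS cdegenS -fmapM IH // fmap1.
- elim=> [|n IH] [|i] h; try (exfalso; lia).
  + exact: counitr.
  + by rewrite cfaceS cface0 cdegen0 counitr.
  + by rewrite cfaceS cdegenS -fmapM IH // fmap1.
- elim=> [|n IH] [|[|i]] [|j] h; try (exfalso; lia).
  + have -> : i = 0 by lia.
    by rewrite /= (natural (comult G)).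
  + by rewrite !cfaceS !cdegen0 (natural (comult G)).
  + exact (fmap_square G (IH i.+1 j h)).
Defined.

Lemma cpow_map1 (C : category) (G : functor C C) n (X : C) :
  cpow_map G n (idm X) = idm (cpow G n X).
Proof. by elim: n => //= n ->; apply: fmap1. Qed.

Lemma cpow_mapM (C : category) (G : functor C C) n (X Y Z : C)
    (g : hom Y Z) (f : hom X Y) :
  cpow_map G n (g ∘ f) = cpow_map G n g ∘ cpow_map G n f.
Proof. by elim: n => //= n ->; apply: fmapM. Qed.

Definition resolution_mor (C : category) (G : comonad C) (X Y : C)
  (f : hom X Y) : smor (resolution_obj G X) (resolution_obj G Y).
Proof.
exists (fun n => cpow_map G n.+1 f).
- move=> n; suff H k i : i <= k ->
    cpow_map G k f ∘ cface G X k i = cface G Y k i ∘ cpow_map G k.+1 f.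
    by move=> i h; apply: H.
  elim: k i => [|k IH] [|i] h; try (exfalso; lia).
  + exact (esym (natural (counit G) f)).
  + exact (esym (natural (counit G) (cpow_map G k.+1 f))).
  + exact (fmap_square G (IH i h)).
- elim=> [|n IH] [|i] h; try (exfalso; lia).
  + exact (esym (natural (comult G) f)).
  + exact (esym (natural (comult G) (cpow_map G n.+1 f))).
  + exact (fmap_square G (IH i h)).
Defined.

Definition resolution (C : category) (G : comonad C) :
  functor C (simplicial_category C).
Proof.
apply: (@Functor C (simplicial_category C) (resolution_obj G)
  (@resolution_mor C G)).
- by move=> X; apply: smor_ext => n; apply: cpow_map1.
- by move=> X Y Z g f; apply: smor_ext => n; apply: cpow_mapM.
Defined.

Definition is_initial (C : category) (I : C) : Prop :=
  forall X : C, exists! f : hom I X, True.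

Definition is_terminal (C : category) (T : C) : Prop :=
  forall X : C, exists! f : hom X T, True.

Definition is_zero (C : category) (Z : C) : Prop :=
  is_initial Z /\ is_terminal Z.

Definition is_zero_mor (C : category) (X Y : C) (f : hom X Y) : Prop :=
  exists Z : C, is_zero Z /\ exists (v : hom Z Y) (u : hom X Z), f = v ∘ u.

Definition is_pullback (C : category) (X Y Z P : C) (f : hom X Z)
    (g : hom Y Z) (p : hom P X) (q : hom P Y) : Prop :=
  f ∘ p = g ∘ q /\
  forall (T : C) (a : hom T X) (b : hom T Y), f ∘ a = g ∘ b ->
    exists! t : hom T P, p ∘ t = a /\ q ∘ t = b.

Definition is_kernel_pair (C : category) (X Y R : C) (f : hom X Y)
    (r0 r1 : hom R X) : Prop := is_pullback f f r0 r1.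

Definition is_coequalizer (C : category) (X Y Q : C) (f g : hom X Y)
    (q : hom Y Q) : Prop :=
  q ∘ f = q ∘ g /\
  forall (T : C) (h : hom Y T), h ∘ f = h ∘ g -> exists! t : hom Q T, t ∘ q = h.

Definition is_coproduct (C : category) (X Y S : C) (i : hom X S) (j : hom Y S) :
    Prop :=
  forall (T : C) (a : hom X T) (b : hom Y T),
    exists! t : hom S T, t ∘ i = a /\ t ∘ j = b.

Definition is_kernel (C : category) (X Y K : C) (f : hom X Y) (k : hom K X) :
    Prop :=
  is_zero_mor (f ∘ k) /\
  forall (T : C) (h : hom T X), is_zero_mor (f ∘ h) ->
    exists! t : hom T K, k ∘ t = h.

Definition is_cokernel (C : category) (X Y Q : C) (f : hom X Y) (q : hom Y Q) :
    Prop :=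
  is_zero_mor (q ∘ f) /\
  forall (T : C) (h : hom Y T), is_zero_mor (h ∘ f) ->
    exists! t : hom Q T, t ∘ q = h.

Definition regular_epi (C : category) (Y Q : C) (q : hom Y Q) : Prop :=
  exists (X : C) (f g : hom X Y), is_coequalizer f g q.

(* Finite completeness is expressed by the existence of a terminal object and
   of pullbacks. *)
Record regular_category (C : category) : Prop := {
  regular_terminal : exists T : C, is_terminal T;
  regular_pullback : forall (X Y Z : C) (f : hom X Z) (g : hom Y Z),
    exists (P : C) (p : hom P X) (q : hom P Y), is_pullback f g p q;
  regular_coequalizer : forall (X Y R : C) (f : hom X Y) (r0 r1 : hom R X),
    is_kernel_pair f r0 r1 ->
    exists (Q : C) (q : hom X Q), is_coequalizer r0 r1 q;
  regular_stable : forall (X Y Z P : C) (f : hom X Z) (g : hom Y Z)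
    (p : hom P X) (q : hom P Y),
    is_pullback f g p q -> regular_epi f -> regular_epi q }.

Definition related (C : category) (X R T : C) (r0 r1 : hom R X)
    (a b : hom T X) : Prop := exists t : hom T R, r0 ∘ t = a /\ r1 ∘ t = b.

Record equivalence_relation (C : category) (X R : C) (r0 r1 : hom R X) :
    Prop := {
  eqrel_mono : forall (T : C) (s t : hom T R),
    r0 ∘ s = r0 ∘ t -> r1 ∘ s = r1 ∘ t -> s = t;
  eqrel_refl : forall (T : C) (a : hom T X), related r0 r1 a a;
  eqrel_sym : forall (T : C) (a b : hom T X),
    related r0 r1 a b -> related r0 r1 b a;
  eqrel_trans : forall (T : C) (a b c : hom T X),
    related r0 r1 a b -> related r0 r1 b c -> related r0 r1 a c }.

Record barr_exact (C : category) : Prop := {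
  exact_regular : regular_category C;
  exact_effective : forall (X R : C) (r0 r1 : hom R X),
    equivalence_relation r0 r1 ->
    exists (Y : C) (f : hom X Y), is_kernel_pair f r0 r1 }.

Definition regular_short_five (C : category) : Prop :=
  forall (K' X' Y' K X Y : C)
    (k' : hom K' X') (f' : hom X' Y') (k : hom K X) (f : hom X Y)
    (u : hom K' K) (v : hom X' X) (w : hom Y' Y),
    regular_epi f' -> is_kernel f' k' -> regular_epi f -> is_kernel f k ->
    v ∘ k' = k ∘ u -> f ∘ v = w ∘ f' ->
    is_iso u -> is_iso w -> is_iso v.

Record semi_abelian (C : category) : Prop := {
  sa_pointed : exists Z : C, is_zero Z;
  sa_exact : barr_exact C;
  sa_protomodular : regular_short_five C;
  sa_coproduct : forall X Y : C,
    exists (S : C) (i : hom X S) (j : hom Y S), is_coproduct i j }.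

(* The axioms do not mention cokernels. They are obtained as coequalizers of
   reflexive graphs: the image of a reflexive graph is an equivalence relation
   by protomodularity, hence effective, and it has a coequalizer. *)
Section Cokernels.
Context (A : category) (hA : semi_abelian A).
Implicit Types X Y Z T : A.

Lemma zero_mor_exists X Y : exists f : hom X Y, is_zero_mor f.
Proof.
have [Z zZ] := sa_pointed hA.
have [v _] := zZ.1 Y; have [u _] := zZ.2 X.
by exists (v ∘ u), Z; split=> //; exists v, u.
Qed.

Lemma zero_mor_uniq X Y (f g : hom X Y) :
  is_zero_mor f -> is_zero_mor g -> f = g.
Proof.
move=> [Z [zZ [v [u ->]]]] [Z' [zZ' [v' [u' ->]]]].
have [w _] := zZ.1 Z'.
have -> : u' = w ∘ u.
  have [x [_ Hx]] := zZ'.2 X.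
  by rewrite -(Hx u' I) -(Hx (w ∘ u) I).
rewrite compA; congr (_ ∘ _).
have [x [_ Hx]] := zZ.1 Y.
by rewrite -(Hx v I) -(Hx (v' ∘ w) I).
Qed.

Lemma zero_mor_l X Y Z (g : hom Y Z) (f : hom X Y) :
  is_zero_mor g -> is_zero_mor (g ∘ f).
Proof.
by move=> [O [zO [v [u ->]]]]; exists O; split=> //; exists v, (u ∘ f);
   rewrite compA.
Qed.

Lemma zero_mor_r X Y Z (g : hom Y Z) (f : hom X Y) :
  is_zero_mor f -> is_zero_mor (g ∘ f).
Proof.
by move=> [O [zO [v [u ->]]]]; exists O; split=> //; exists (g ∘ v), u;
   rewrite compA.
Qed.

Lemma zero_mor_to X Z (f : hom X Z) : is_zero Z -> is_zero_mor f.
Proof. by move=> zZ; exists Z; split=> //; exists (idm Z), f; rewrite comp1m. Qed.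

Lemma kernel_mono X Y K (f : hom X Y) (k : hom K X) T (s t : hom T K) :
  is_kernel f k -> k ∘ s = k ∘ t -> s = t.
Proof.
move=> [z U] e.
have [|x [_ Hx]] := U T (k ∘ t); first by rewrite compA; apply: zero_mor_l.
by rewrite -(Hx s e) -(Hx t erefl).
Qed.

Lemma cokernel_epi X Y Q (f : hom X Y) (q : hom Y Q) T (s t : hom Q T) :
  is_cokernel f q -> s ∘ q = t ∘ q -> s = t.
Proof.
move=> [z U] e.
have [|x [_ Hx]] := U T (t ∘ q); first by rewrite -compA; apply: zero_mor_r.
by rewrite -(Hx s e) -(Hx t erefl).
Qed.

Lemma coequalizer_epi X Y Q (f g : hom X Y) (q : hom Y Q) T (s t : hom Q T) :
  is_coequalizer f g q -> s ∘ q = t ∘ q -> s = t.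
Proof.
move=> [z U] e.
have [|x [_ Hx]] := U T (t ∘ q); first by rewrite -!compA z.
by rewrite -(Hx s e) -(Hx t erefl).
Qed.

Lemma regular_epi_epi Y Q (q : hom Y Q) T (s t : hom Q T) :
  regular_epi q -> s ∘ q = t ∘ q -> s = t.
Proof. by move=> [X [f [g c]]]; apply: coequalizer_epi c. Qed.

Lemma pullback_mono X Y Z P (f : hom X Z) (g : hom Y Z) (p : hom P X)
    (q : hom P Y) T (s t : hom T P) :
  is_pullback f g p q -> p ∘ s = p ∘ t -> q ∘ s = q ∘ t -> s = t.
Proof.
move=> [z U] e1 e2.
have [|x [_ Hx]] := U T (p ∘ t) (q ∘ t); first by rewrite !compA z.
by rewrite -(Hx s (conj e1 e2)) -(Hx t (conj erefl erefl)).
Qed.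

Let pb X Y Z (f : hom X Z) (g : hom Y Z) :=
  regular_pullback (exact_regular (sa_exact hA)) f g.

Lemma kernel_exists X Y (f : hom X Y) :
  exists (K : A) (k : hom K X), is_kernel f k.
Proof.
have [Z zZ] := sa_pointed hA; have [v _] := zZ.1 Y.
have [K [k [q Hpb]]] := pb f v.
exists K, k; split.
  by rewrite Hpb.1; apply: zero_mor_r; apply: zero_mor_to.
move=> T h zh; have [u _] := zZ.2 T.
have e : f ∘ h = v ∘ u.
  by apply: zero_mor_uniq => //; exists Z; split=> //; exists v, u.
have [t [[t1 _] _]] := Hpb.2 T h u e.
exists t; split=> // t' e'; apply: (pullback_mono Hpb); first by rewrite t1.
by have [w [_ Hw]] := zZ.2 T; rewrite -(Hw (q ∘ t) I) -(Hw (q ∘ t') I).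
Qed.

Lemma product_exists X Y : exists (P : A) (p : hom P X) (q : hom P Y),
  forall T (a : hom T X) (b : hom T Y),
    exists! t : hom T P, p ∘ t = a /\ q ∘ t = b.
Proof.
have [Z zZ] := sa_pointed hA; have [f Hf] := zZ.2 X; have [g Hg] := zZ.2 Y.
have [P [p [q Hpb]]] := pb f g; exists P, p, q => T a b; apply: Hpb.2.
by have [w [_ Hw]] := zZ.2 T; rewrite -(Hw (f ∘ a) I) -(Hw (g ∘ b) I).
Qed.

Lemma split_subobject_iso W V M N (q : hom W V) (t : hom V W) (k : hom N W)
    (m : hom M W) (t' : hom V M) (k' : hom N M) :
  (forall T (a b : hom T M), m ∘ a = m ∘ b -> a = b) ->
  q ∘ t = idm V -> is_kernel q k -> m ∘ t' = t -> m ∘ k' = k -> is_iso m.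
Proof.
move=> mono_m qt Hk et ek.
have split_reg X Y (f : hom X Y) s : f ∘ s = idm Y -> regular_epi f.
  move=> fs; exists X, (s ∘ f), (idm X); split.
    by rewrite compA fs comp1m compm1.
  move=> T h e; exists (h ∘ s); split; first by rewrite -compA e compm1.
  by move=> u <-; rewrite -compA fs compm1.
have id_iso X : is_iso (idm X) by exists (idm X); rewrite comp1m.
apply: (sa_protomodular hA (k' := k') (f' := q ∘ m) (k := k) (f := q)
  (u := idm N) (w := idm V)) => //.
- by apply: (split_reg _ _ _ t'); rewrite -compA et.
- split; first by rewrite -compA ek; case: Hk.
  move=> T h; rewrite -compA => z; have [x [Hx Ux]] := Hk.2 T _ z.
  exists x; split; first by apply: mono_m; rewrite compA ek.
  by move=> y ey; apply: Ux; rewrite -ey compA ek.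
- exact: split_reg qt.
- by rewrite compm1.
- by rewrite comp1m.
Qed.

Lemma reflexive_difunctional X R (r0 r1 : hom R X) (e : hom X R) :
  (forall T (s t : hom T R), r0 ∘ s = r0 ∘ t -> r1 ∘ s = r1 ∘ t -> s = t) ->
  r0 ∘ e = idm X -> r1 ∘ e = idm X ->
  forall T (x y z w : hom T X), related r0 r1 x y -> related r0 r1 z y ->
    related r0 r1 z w -> related r0 r1 x w.
Proof.
move=> mono_r re0 re1.
have [U [u [u' HU]]] := pb r1 r1.
have [V [v [v' HV]]] := pb r0 r0.
have [W [p [q HW]]] := pb u v.
have [XX [pi0 [pi1 HX]]] := product_exists X X.
have [r [[r_0 r_1] _]] := HX _ r0 r1.
have [c [[c_0 c_1] _]] := HX _ (r0 ∘ u' ∘ p) (r1 ∘ v' ∘ q).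
have [M [m [rho HM]]] := pb c r.
have mono_m T (a b : hom T M) : m ∘ a = m ∘ b -> a = b.
  move=> eab; apply: (pullback_mono HM) => //.
  have erho : r ∘ (rho ∘ a) = r ∘ (rho ∘ b).
    by rewrite !compA -HM.1 -!compA eab.
  by apply: mono_r; [rewrite -r_0 | rewrite -r_1]; rewrite -!compA erho.
have in_M T (a : hom T W) (s : hom T R) :
    r0 ∘ s = r0 ∘ u' ∘ p ∘ a -> r1 ∘ s = r1 ∘ v' ∘ q ∘ a ->
    exists a', m ∘ a' = a.
  move=> s0 s1; have [|a' [[e1 _] _]] := HM.2 T a s; last by exists a'.
  have [x [_ Ux]] := HX _ (r0 ∘ s) (r1 ∘ s).
  rewrite -(Ux (c ∘ a)) ?(Ux (r ∘ s)) //.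
    by rewrite !compA r_0 r_1.
  by rewrite !compA c_0 c_1 s0 s1.
have [d [[d1 d2] _]] := HU.2 R (idm R) (idm R) erefl.
have [|t [[t1 t2] _]] := HW.2 V (d ∘ v) (idm V).
  by rewrite compA d1 comp1m compm1.
have [N [k Hk]] := kernel_exists q.
have [t' et'] : exists t', m ∘ t' = t.
  apply: (in_M _ _ v').
    rewrite -!compA t1 [u' ∘ _]compA d2 comp1m.
    by rewrite HV.1.
  by rewrite -[_ ∘ q ∘ t]compA t2 compm1.
have [k' ek'] : exists k', m ∘ k' = k.
  apply: (in_M _ _ (u' ∘ p ∘ k)); first by rewrite !compA.
  rewrite !compA -HU.1 -[r1 ∘ u ∘ p]compA HW.1 !compA -!compA.
  by apply: zero_mor_uniq; do 2?apply: zero_mor_r; apply: Hk.1.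
have [mi [_ mmi]] := split_subobject_iso mono_m t2 Hk et' ek'.
move=> T x y z w [a [a0 a1]] [b [b0 b1]] [f [f0 f1]].
have [|l [[l0 l1] _]] := HU.2 T b a; first by rewrite a1 b1.
have [|n [[n0 n1] _]] := HV.2 T b f; first by rewrite b0 f0.
have [|o [[o0 o1] _]] := HW.2 T l n; first by rewrite l0 n0.
have eM : c ∘ o = r ∘ (rho ∘ mi ∘ o).
  by rewrite !compA -HM.1 -[_ ∘ m ∘ _]compA mmi compm1.
exists (rho ∘ mi ∘ o); split.
  by rewrite -r_0 -compA -eM compA c_0 -!compA o0 l1.
by rewrite -r_1 -compA -eM compA c_1 -!compA o1 n1.
Qed.

Lemma regular_image X Y (f : hom X Y) :
  exists (I : A) (q : hom X I) (m : hom I Y),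
    [/\ f = m ∘ q, regular_epi q &
        forall T (a b : hom T I), m ∘ a = m ∘ b -> a = b].
Proof.
have reg := exact_regular (sa_exact hA).
have [R [r0 [r1 HR]]] := pb f f.
have [I [q Hq]] := regular_coequalizer reg HR.
have rq : regular_epi q by exists R, r0, r1.
have [m [em _]] := Hq.2 _ f HR.1.
exists I, q, m; split=> // T a b eab.
have [P [x [e1 HP]]] := pb q a.
have [P' [y [e2 HP']]] := pb q (b ∘ e1).
have r1' := regular_stable reg HP rq; have r2' := regular_stable reg HP' rq.
apply: (regular_epi_epi r1'); apply: (regular_epi_epi r2').
have [|t [[t0 t1] _]] := HR.2 _ (x ∘ e2) y.
  by rewrite -em -!compA HP'.1 [q ∘ (x ∘ _)]compA HP.1 !compA eab.
by rewrite -HP.1 -HP'.1 -compA -t0 -t1 !compA Hq.1.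
Qed.

Lemma reflexive_coequalizer X Y (d c : hom X Y) (e : hom Y X) :
  d ∘ e = idm Y -> c ∘ e = idm Y ->
  exists (Q : A) (q : hom Y Q), is_coequalizer d c q.
Proof.
move=> de ce; have ex := sa_exact hA.
have [YY [pi0 [pi1 HY]]] := product_exists Y Y.
have [f [[f0 f1] _]] := HY _ d c.
have [R [p [m [ef rp mono_m]]]] := regular_image f.
have mono_r T (s t : hom T R) :
    (pi0 ∘ m) ∘ s = (pi0 ∘ m) ∘ t -> (pi1 ∘ m) ∘ s = (pi1 ∘ m) ∘ t -> s = t.
  rewrite -!compA => e0 e1; apply: mono_m.
  have [x [_ Ux]] := HY _ (pi0 ∘ (m ∘ t)) (pi1 ∘ (m ∘ t)).
  by rewrite -(Ux (m ∘ s)) // -(Ux (m ∘ t)).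
have pd : pi0 ∘ m ∘ p = d by rewrite -compA -ef.
have pc : pi1 ∘ m ∘ p = c by rewrite -compA -ef.
have re0 : pi0 ∘ m ∘ (p ∘ e) = idm Y by rewrite compA pd.
have re1 : pi1 ∘ m ∘ (p ∘ e) = idm Y by rewrite compA pc.
have dif := reflexive_difunctional mono_r re0 re1.
have refl T (a : hom T Y) : related (pi0 ∘ m) (pi1 ∘ m) a a.
  by exists (p ∘ e ∘ a); rewrite !compA pd pc de ce comp1m.
have [|Z [g Hg]] := exact_effective ex (r0 := pi0 ∘ m) (r1 := pi1 ∘ m).
  split=> // [T a b ab|T a b c' ab bc].
    exact: dif (refl _ b) ab (refl _ a).
  exact: dif ab (refl _ b) bc.
have [Q [q Hq]] := regular_coequalizer (exact_regular ex) Hg.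
exists Q, q; split; first by rewrite -pd -pc !compA -(compA q) Hq.1 !compA.
move=> T h eh; apply: Hq.2; apply: (regular_epi_epi rp).
by rewrite -!(compA h) pd pc.
Qed.

Lemma cokernel_exists X Y (f : hom X Y) :
  exists (Q : A) (q : hom Y Q), is_cokernel f q.
Proof.
have [S [i [j HS]]] := sa_coproduct hA Y X.
have [z zz] := zero_mor_exists X Y.
have [d [[di dj] _]] := HS _ (idm Y) z.
have [c [[ci cj] _]] := HS _ (idm Y) f.
have [Q [q Hq]] := reflexive_coequalizer di ci.
exists Q, q; split.
  by rewrite -cj compA -Hq.1 -compA dj; apply: zero_mor_r.
move=> T h zh; apply: Hq.2.
have [x [_ Ux]] := HS _ h (h ∘ f).
rewrite -(Ux (h ∘ d)) ?(Ux (h ∘ c)) //.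
  by rewrite -!compA ci cj compm1.
rewrite -!compA di dj compm1; split=> //.
by apply: zero_mor_uniq => //; apply: zero_mor_r.
Qed.

End Cokernels.

Record over (C : category) (X : C) := Over { odom : C; oarr : hom odom X }.
Arguments Over {C X} odom oarr.

Record under (C : category) (X : C) := Under { ucod : C; uarr : hom X ucod }.
Arguments Under {C X} ucod uarr.

Section Homology.
Context (A : category) (hA : semi_abelian A).
Implicit Types X Y Z T : A.

Definition zero_object : A :=
  sval (constructive_indefinite_description _ (sa_pointed hA)).

Lemma zero_objectP : is_zero zero_object.
Proof. by rewrite /zero_object; case: constructive_indefinite_description. Qed.

Definition zero_mor X Y : hom X Y :=
  sval (constructive_indefinite_description _ (zero_mor_exists hA X Y)).

Lemma over_kernel_exists X Y (f : hom X Y) :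
  exists k : over X, is_kernel f (oarr k).
Proof. by have [K [k H]] := kernel_exists hA f; exists (Over K k). Qed.

Definition kernel X Y (f : hom X Y) : over X :=
  sval (constructive_indefinite_description _ (over_kernel_exists f)).

Lemma kernelP X Y (f : hom X Y) : is_kernel f (oarr (kernel f)).
Proof. by rewrite /kernel; case: constructive_indefinite_description. Qed.

Lemma under_cokernel_exists X Y (f : hom X Y) :
  exists q : under Y, is_cokernel f (uarr q).
Proof. by have [Q [q H]] := cokernel_exists hA f; exists (Under Q q). Qed.

Definition cokernel X Y (f : hom X Y) : under Y :=
  sval (constructive_indefinite_description _ (under_cokernel_exists f)).

Lemma cokernelP X Y (f : hom X Y) : is_cokernel f (uarr (cokernel f)).
Proof. by rewrite /cokernel; case: constructive_indefinite_description. Qed.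

Definition is_intersection X (a b c : over X) : Prop :=
  exists (p : hom (odom c) (odom a)) (q : hom (odom c) (odom b)),
    is_pullback (oarr a) (oarr b) p q /\ oarr c = oarr a ∘ p.

Lemma intersection_exists X (a b : over X) :
  exists c : over X, is_intersection a b c.
Proof.
have [P [p [q H]]] :=
  regular_pullback (exact_regular (sa_exact hA)) (oarr a) (oarr b).
by exists (Over P (oarr a ∘ p)), p, q.
Qed.

Definition intersection X (a b : over X) : over X :=
  sval (constructive_indefinite_description _ (intersection_exists a b)).

Lemma intersectionP X (a b : over X) :
  is_intersection a b (intersection a b).
Proof. by rewrite /intersection; case: constructive_indefinite_description. Qed.

(* Intersection of Ker f_i over i < m; it is [X] itself for m = 0. *)
Fixpoint kernels_meet X Y (f : nat -> hom X Y) (m : nat) : over X :=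
  if m is p.+1 then intersection (kernels_meet f p) (kernel (f p))
  else Over X (idm X).

Definition monic X Y (f : hom X Y) : Prop :=
  forall T (s t : hom T X), f ∘ s = f ∘ t -> s = t.

Lemma kernels_meet_mono X Y (f : nat -> hom X Y) m :
  monic (oarr (kernels_meet f m)).
Proof.
elim: m => [|m IH] T s t /=; first by rewrite !comp1m.
case: (intersectionP (kernels_meet f m) (kernel (f m))) => p [q [H ->]].
rewrite -!compA => /IH e; apply: (pullback_mono H) => //.
apply: (kernel_mono (kernelP (f m))).
by rewrite !compA -H.1 -!compA e.
Qed.

Lemma kernels_meetP X Y (f : nat -> hom X Y) m T (h : hom T X) :
  (exists t, oarr (kernels_meet f m) ∘ t = h) <->
  (forall i, i < m -> is_zero_mor (f i ∘ h)).
Proof.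
elim: m T h => [|m IH] T h /=.
  by split=> // _; exists h; rewrite comp1m.
case: (intersectionP (kernels_meet f m) (kernel (f m))) => p [q [H ->]].
split=> [[t <-] i|h0].
  rewrite ltnS leq_eqVlt => /orP[/eqP ->|lt_im].
    rewrite H.1 !compA; apply: zero_mor_l; apply: zero_mor_l.
    by have [] := kernelP (f m).
  have [Hz _] := IH _ (oarr (kernels_meet f m) ∘ p ∘ t).
  by apply: Hz lt_im; exists (p ∘ t); rewrite compA.
have [t1 e1] : exists t, oarr (kernels_meet f m) ∘ t = h.
  by apply/IH => i lt_im; apply: h0; apply: ltnW.
have [t2 [e2 _]] := (kernelP (f m)).2 _ h (h0 m (ltnSn m)).
have [|t [[e _] _]] := H.2 _ t1 t2; first by rewrite e1 e2.
by exists t; rewrite -compA e e1.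
Qed.

Definition factor X (o : over X) T (h : hom T X)
    (H : exists t : hom T (odom o), oarr o ∘ t = h) : hom T (odom o) :=
  sval (constructive_indefinite_description _ H).

Lemma factorP X (o : over X) T (h : hom T X)
    (H : exists t : hom T (odom o), oarr o ∘ t = h) :
  oarr o ∘ factor H = h.
Proof. by rewrite /factor; case: constructive_indefinite_description. Qed.

Definition cofactor X (u : under X) T (h : hom X T)
    (H : exists t : hom (ucod u) T, t ∘ uarr u = h) : hom (ucod u) T :=
  sval (constructive_indefinite_description _ H).

Lemma cofactorP X (u : under X) T (h : hom X T)
    (H : exists t : hom (ucod u) T, t ∘ uarr u = h) :
  cofactor H ∘ uarr u = h.
Proof. by rewrite /cofactor; case: constructive_indefinite_description. Qed.

Implicit Types S U V : simplicial A.

Definition moore S (n : nat) : over (S n) :=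
  match n return over (S n) with
  | 0 => Over (S 0) (idm (S 0))
  | p.+1 => kernels_meet (face S p) p.+1
  end.

Definition moore_ob S n : A := odom (moore S n).
Definition moore_in S n : hom (moore_ob S n) (S n) := oarr (moore S n).

Lemma moore_mono S n : monic (moore_in S n).
Proof.
case: n => [T s t|n]; last exact: kernels_meet_mono.
by rewrite /moore_in /= !comp1m.
Qed.

Lemma moore_factorS S n T (h : hom T (S n.+1)) :
  (exists t, moore_in S n.+1 ∘ t = h) <->
  (forall i, i <= n -> is_zero_mor (face S n i ∘ h)).
Proof. exact: kernels_meetP. Qed.

Lemma moore_face_zero S n i : i <= n ->
  is_zero_mor (face S n i ∘ moore_in S n.+1).
Proof.
move=> le_in; have [H _] := moore_factorS (moore_in S n.+1).
by apply: H le_in; exists (idm _); rewrite compm1.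
Qed.

Lemma moore_d_factor S n : exists t,
  moore_in S n ∘ t = face S n n.+1 ∘ moore_in S n.+1.
Proof.
case: n => [|n].
  by exists (face S 0 1 ∘ moore_in S 1); rewrite /moore_in /= comp1m.
apply/moore_factorS => i le_in.
rewrite compA (face_face S (i := i) (j := n.+2)); last by lia.
by rewrite -compA; apply/zero_mor_r/moore_face_zero; lia.
Qed.

(* The term of index n - 1 of the Moore complex, which is zero if n = 0. *)
Definition moore_pred S n : A :=
  if n is p.+1 then moore_ob S p else zero_object.

Definition moore_d S n : hom (moore_ob S n) (moore_pred S n) :=
  match n return hom (moore_ob S n) (moore_pred S n) with
  | 0 => zero_mor (moore_ob S 0) zero_object
  | p.+1 => factor (moore_d_factor S p)
  end.

Lemma moore_dS S n :
  moore_in S n ∘ moore_d S n.+1 = face S n n.+1 ∘ moore_in S n.+1.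
Proof. exact: factorP. Qed.

Lemma zero_mor_mono X Y Z (m : hom Y Z) (f : hom X Y) :
  monic m -> is_zero_mor (m ∘ f) -> is_zero_mor f.
Proof.
move=> mono_m z; have [g zg] := zero_mor_exists hA X Y.
suff -> : f = g by [].
by apply: mono_m; apply: (zero_mor_uniq z); apply: zero_mor_r.
Qed.

Lemma moore_dd S n :
  is_zero_mor (moore_d S n ∘ (moore_d S n.+1 : hom _ (moore_ob S n))).
Proof.
case: n => [|n]; first exact: zero_mor_to zero_objectP.
apply: (zero_mor_mono (@moore_mono S n)).
rewrite compA moore_dS -compA moore_dS compA.
rewrite (face_face S (i := n.+1) (j := n.+2)); last by lia.
by rewrite -compA; apply/zero_mor_r/moore_face_zero.
Qed.

Definition cycles S n : over (moore_ob S n) := kernel (moore_d S n).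

Lemma kernel_factor X Y (f : hom X Y) T (h : hom T X) :
  is_zero_mor (f ∘ h) -> exists t, oarr (kernel f) ∘ t = h.
Proof. by move=> z; have [t [e _]] := (kernelP f).2 T h z; exists t. Qed.

Definition boundary S n : hom (moore_ob S n.+1) (odom (cycles S n)) :=
  factor (kernel_factor (moore_dd S n)).

Definition homology_quotient S n : under (odom (cycles S n)) :=
  cokernel (boundary S n).

Definition homology_ob n S : A := ucod (homology_quotient S n).

Lemma moore_map_factor S U (s : smor S U) n :
  exists t, moore_in U n ∘ t = s n ∘ moore_in S n.
Proof.
case: n => [|n].
  by exists (s 0 ∘ moore_in S 0); rewrite /moore_in /= comp1m.
apply/moore_factorS => i le_in; rewrite compA -smor_face; last by lia.
by rewrite -compA; apply/zero_mor_r/moore_face_zero.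
Qed.

Definition moore_map S U (s : smor S U) n : hom (moore_ob S n) (moore_ob U n) :=
  factor (moore_map_factor s n).

Lemma moore_mapE S U (s : smor S U) n :
  moore_in U n ∘ moore_map s n = s n ∘ moore_in S n.
Proof. exact: factorP. Qed.

Lemma moore_map_d S U (s : smor S U) n :
  (moore_d U n.+1 : hom _ (moore_ob U n)) ∘ moore_map s n.+1 =
  moore_map s n ∘ moore_d S n.+1.
Proof.
apply: (@moore_mono U n); rewrite !compA moore_mapE moore_dS.
by rewrite -!compA moore_mapE moore_dS !compA smor_face.
Qed.

Lemma cycles_map_factor S U (s : smor S U) n :
  exists t, oarr (cycles U n) ∘ t = moore_map s n ∘ oarr (cycles S n).
Proof.
apply: kernel_factor; case: n => [|n].
  exact: zero_mor_to zero_objectP.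
rewrite compA moore_map_d -compA; apply: zero_mor_r.
exact: (kernelP (moore_d S n.+1)).1.
Qed.

Definition cycles_map S U (s : smor S U) n :
    hom (odom (cycles S n)) (odom (cycles U n)) :=
  factor (cycles_map_factor s n).

Lemma cycles_mapE S U (s : smor S U) n :
  oarr (cycles U n) ∘ cycles_map s n = moore_map s n ∘ oarr (cycles S n).
Proof. exact: factorP. Qed.

Lemma cycles_map_boundary S U (s : smor S U) n :
  cycles_map s n ∘ boundary S n = boundary U n ∘ moore_map s n.+1.
Proof.
apply: (kernel_mono (kernelP (moore_d U n))).
rewrite !compA cycles_mapE -[moore_map s n ∘ _ ∘ _]compA !factorP.
by rewrite -moore_map_d.
Qed.

Lemma homology_map_factor S U (s : smor S U) n :
  exists t, t ∘ uarr (homology_quotient S n) =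
    uarr (homology_quotient U n) ∘ cycles_map s n.
Proof.
have [|t [e _]] := (cokernelP (boundary S n)).2 _
  (uarr (homology_quotient U n) ∘ cycles_map s n); last by exists t.
rewrite -compA cycles_map_boundary compA; apply: zero_mor_l.
exact: (cokernelP (boundary U n)).1.
Qed.

Definition homology_map n S U (s : smor S U) :
    hom (homology_ob n S) (homology_ob n U) :=
  cofactor (homology_map_factor s n).

Lemma homology_mapE n S U (s : smor S U) :
  homology_map n s ∘ uarr (homology_quotient S n) =
  uarr (homology_quotient U n) ∘ cycles_map s n.
Proof. exact: cofactorP. Qed.

Lemma homology_map_id n S :
  homology_map n (smor_id S) = idm (homology_ob n S).
Proof.
apply: (cokernel_epi (cokernelP (boundary S n))).
rewrite homology_mapE comp1m.
suff -> : cycles_map (smor_id S) n = idm _ by rewrite compm1.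
apply: (kernel_mono (kernelP (moore_d S n))).
rewrite cycles_mapE compm1.
suff -> : moore_map (smor_id S) n = idm _ by rewrite comp1m.
by apply: moore_mono; rewrite moore_mapE comp1m compm1.
Qed.

Lemma homology_map_comp n S U V (t : smor U V) (s : smor S U) :
  homology_map n (smor_comp t s) = homology_map n t ∘ homology_map n s.
Proof.
apply: (cokernel_epi (cokernelP (boundary S n))).
rewrite homology_mapE -compA homology_mapE compA homology_mapE -compA.
congr (_ ∘ _); apply: (kernel_mono (kernelP (moore_d V n))).
rewrite cycles_mapE compA cycles_mapE -compA cycles_mapE compA.
congr (_ ∘ _); apply: moore_mono.
by rewrite moore_mapE compA moore_mapE -!compA moore_mapE.
Qed.

Definition homology (n : nat) : functor (simplicial_category A) A :=
  @Functor (simplicial_category A) A (homology_ob n) (@homology_map n)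
    (homology_map_id n) (@homology_map_comp n).

End Homology.

(* The functor H_n(-, E)_G, which is meaningful for n >= 1. *)
Definition comonad_homology (C A : category) (hA : semi_abelian A)
    (G : comonad C) (E : functor C A) (n : nat) : functor C A :=
  compF (homology hA n.-1) (compF (simplicial_map E) (resolution G)).

(* Main.v *)
From mathcomp Require Import all_boot zify.
Require Import Defs.
From Stdlib Require Import ClassicalEpsilon.

(** Both resolutions consist of projectives in degrees at least 0, and a
    contractible Kan augmented simplicial set has fillers for all spheres.
    Filling spheres degree by degree produces comparison maps between the two
    resolutions that commute with the faces (not with the degeneracies), and, in
    the same way, a semi-simplicial map from the cylinder, i.e. a homotopy,
    between any two such maps over the same morphism. In the semi-abelian
    category homotopic maps agree on homology: among the elements of degree n+1
    whose faces vanish except those of index j and j+1, the degenerate ones and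
    those with vanishing j-th face are jointly epic by protomodularity, so that
    by descending induction on j the faces j and j+1 are homologous. *)

Set Implicit Arguments.
Unset Strict Implicit.
Unset Printing Implicit Defensive.

Local Open Scope cat_scope.

(** * Dependent choice *)

Lemma dependent_choice (T : nat -> Type) (Q : forall n, T n -> Prop)
    (R : forall n, T n -> T n.+1 -> Prop) :
  (exists t, Q 0 t) ->
  (forall n t, Q n t -> exists t', Q n.+1 t' /\ R n t t') ->
  exists s : forall n, T n, forall n, Q n (s n) /\ R n (s n) (s n.+1).
Proof.
move=> ex0 exS.
pose u0 : {t | Q 0 t} := constructive_indefinite_description _ ex0.
pose step n (u : {t | Q n t}) :=
  constructive_indefinite_description _ (exS n _ (proj2_sig u)).
pose next n u : {t | Q n.+1 t} := exist _ _ (proj1 (proj2_sig (step n u))).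
pose s := fix s n : {t | Q n t} := if n is m.+1 then next m (s m) else u0.
exists (fun n => proj1_sig (s n)) => n; split; first exact: proj2_sig (s n).
exact: proj2 (proj2_sig (step n (s n))).
Qed.

(** * Lifts and homotopies obtained by filling spheres *)

Section Lifting.
Context (C : category) (A B : nat -> C).
Context (dA : forall n, nat -> hom (A n.+1) (A n)).
Context (dB : forall n, nat -> hom (B n.+1) (B n)).

(* Degrees are shifted by one: the term of index 0 is the augmentation. *)
Definition sphere (X : C) n : (nat -> hom X (B n)) -> Prop :=
  match n return (nat -> hom X (B n)) -> Prop with
  | 0 => fun _ => True
  | m.+1 => fun a => forall i j, i < j <= m.+1 ->
      dB m i ∘ a j = dB m j.-1 ∘ a i
  end.

Definition fills_spheres (X : C) : Prop :=
  forall n (a : nat -> hom X (B n)), sphere a ->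
  exists x : hom X (B n.+1), forall i, i <= n -> dB n i ∘ x = a i.

Hypothesis dAA : forall n i j, i < j <= n.+1 ->
  dA n i ∘ dA n.+1 j = dA n j.-1 ∘ dA n.+1 i.
Hypothesis fillB : forall n, fills_spheres (A n.+1).

(* For [d i p = p] and [pre] undefined in positive degrees this yields a lift
   of a given morphism; for the faces of the simplicial interval, with [pre]
   given at the end points, it yields a homotopy. *)
Lemma extend_lift (d : nat -> nat -> nat)
    (pre : forall n, nat -> option (hom (A n) (B n))) :
  (forall i j p, i < j -> d i (d j p) = d j.-1 (d i p)) ->
  (forall p, exists w, pre 0 p = Some w) ->
  (forall n p w i, i <= n -> pre n.+1 p = Some w ->
     exists w', pre n (d i p) = Some w' /\ dB n i ∘ w = w' ∘ dA n i) ->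
  exists y : forall n, nat -> hom (A n) (B n),
    (forall n p w, pre n p = Some w -> y n p = w) /\
    (forall n p i, i <= n -> dB n i ∘ y n.+1 p = y n (d i p) ∘ dA n i).
Proof.
move=> dd pre0 preS.
pose R n (y : nat -> hom (A n) (B n)) (y' : nat -> hom (A n.+1) (B n.+1)) :=
  forall p i, i <= n -> dB n i ∘ y' p = y (d i p) ∘ dA n i.
pose agrees n (y : nat -> hom (A n) (B n)) :=
  forall p w, pre n p = Some w -> y p = w.
(* Besides agreeing with [pre], a stage remembers a previous stage below it: this is what makes the
   next prescribed faces a sphere. *)
pose Q n (y : nat -> hom (A n) (B n)) := agrees n y /\
  match n return (nat -> hom (A n) (B n)) -> Prop with
  | 0 => fun _ => True
  | m.+1 => fun y => exists y0, R m y0 y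
  end y.
have [||y Hy] := @dependent_choice _ Q R.
- exists (fun p => proj1_sig (constructive_indefinite_description _ (pre0 p))).
  split=> // p w; case: constructive_indefinite_description => w' /= ->.
  by case.
- move=> n y [agr Qy].
  have fill p : exists x : hom (A n.+1) (B n.+1),
      (forall w, pre n.+1 p = Some w -> x = w) /\
      forall i, i <= n -> dB n i ∘ x = y (d i p) ∘ dA n i.
    case e: (pre n.+1 p) => [w|].
      exists w; split=> [_ [<-] //|i le_in].
      by have [w' [/agr -> ->]] := preS _ _ _ _ le_in e.
    have [|x Hx] := fillB (a := fun i => y (d i p) ∘ dA n i); last by exists x.
    (* Both sides of the sphere condition reduce to [y0] after two faces, where [dAA] and [dd] match
       them. *)
    case: n y {agr e} Qy => //= n y [y0 Ry] i j lt_ij.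
    rewrite !compA !Ry; try lia.
    rewrite -!compA dAA // dd //; lia.
  pose x p := constructive_indefinite_description _ (fill p).
  exists (fun p => proj1_sig (x p)); split.
    split=> [p w /(proj1 (proj2_sig (x p))) //|].
    by exists y => p i; apply: (proj2 (proj2_sig (x p))).
  by move=> p i; apply: (proj2 (proj2_sig (x p))).
- exists y; split=> [n|n p i]; first by case: (Hy n) => -[].
  by case: (Hy n) => _; apply.
Qed.

Definition face_map (f : forall n, hom (A n) (B n)) : Prop :=
  forall n i, i <= n -> dB n i ∘ f n.+1 = f n ∘ dA n i.

Lemma lift_exists (b : hom (A 0) (B 0)) : exists f, f 0 = b /\ face_map f.
Proof.
have [|p|n p w i _ //|y [y0 Hy]] := @extend_lift (fun _ p => p)
  (fun n => match n with 0 => fun _ => Some b | _ => fun _ => None end) => //.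
  by exists b.
by exists (fun n => y n 0); split=> [|n i]; [apply: y0 | apply: Hy].
Qed.

(* A monotone map to {0 < 1} is encoded by the number p of vertices sent to 0;
   deleting vertex i lowers that number exactly if i < p. *)
Definition interval_face i p := if i < p then p.-1 else p.

(** By the shift, index [n] has [n] vertices, so the constant maps are [p = 0] and [p = n]; [f] and
    [g] are prescribed there and the rest is filled in. *)
Lemma homotopy_exists (f g : forall n, hom (A n) (B n)) :
  face_map f -> face_map g -> f 0 = g 0 ->
  exists y : forall n, nat -> hom (A n) (B n),
    [/\ forall n, y n 0 = f n, forall n, y n n = g n &
        forall n p i, i <= n ->
          dB n i ∘ y n.+1 p = y n (interval_face i p) ∘ dA n i].
Proof.
move=> Hf Hg fg0.
pose pre n p :=
  if p == 0 then Some (f n) else if n <= p then Some (g n) else None.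
have [i j p lt_ij|p|n p w i le_in|y [Hpre Hy]] :=
    @extend_lift interval_face pre.
- rewrite /interval_face.
  by case: (ltnP i p); case: (ltnP j p) => *; repeat case: ltnP => *; lia.
- by rewrite /pre; case: eqP => _; [exists (f 0) | exists (g 0)].
- rewrite /pre /interval_face; case: eqP => [-> [<-]|p0].
    by exists (f n); rewrite /= Hf.
  case: (leqP n.+1 p) => // lt_np [<-]; rewrite (leq_ltn_trans le_in lt_np).
  exists (g n); rewrite Hg //; split=> //.
  (* The end points collide only at [n = 0], where [f 0 = g 0] settles the conflict. *)
  case: eqP => [p1|_]; last by case: leqP => //; lia.
  have n0 : n = 0 by lia.
  by subst n; rewrite fg0.
exists y; split=> // [n|n]; apply: Hpre; rewrite /pre //.
by case: eqP => [->|_]; rewrite ?fg0 ?leqnn.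
Qed.

End Lifting.

(** * Comonad resolutions: contractibility and sphere filling *)

Section Resolution.
Context (C : category) (K : comonad C).

Lemma cface_cface X n i j : i < j <= n.+1 ->
  cface K X n i ∘ cface K X n.+1 j = cface K X n j.-1 ∘ cface K X n.+1 i.
Proof.
case: n => [|n] h; last exact: (face_face (resolution_obj K X) h).
have [-> ->] : i = 0 /\ j = 1 by lia.
exact: (natural (counit K)).
Qed.

Lemma cpow_map_cface X Y (f : hom X Y) n i : i <= n ->
  cface K Y n i ∘ cpow_map K n.+1 f = cpow_map K n f ∘ cface K X n i.
Proof.
case: n => [|n] h; last exact: (esym (smor_face (resolution_mor K f) h)).
have -> : i = 0 by lia.
exact: (natural (counit K)).
Qed.

Definition augmented_resolution (X : C) : augmented C :=
  @Augmented C (resolution_obj K X) X (counit K X)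
    (esym (cface_cface X (n := 0) (i := 0) (j := 1) isT)).

Context (P : projective_class C) (genK : generates K P).

Lemma pobj_cofree X : pobj P (K X).
Proof. by apply: (proj2 (genK.1 _)) => Y Z e; apply. Qed.

(** The counit at [X] is epic for every [K Z]: a morphism [y] from [K Z] lifts to
    [fmap K y ∘ comult K Z]. *)
Lemma pobj_section X : pobj P X -> exists s, counit K X ∘ s = idm X.
Proof.
move=> /(proj1 (genK.1 X)) prX; apply: prX => Z y.
exists (fmap K y ∘ comult K Z).
by rewrite compA (natural (counit K)) -compA counitl compm1.
Qed.

Lemma resolution_contraction X Y : pobj P X ->
  exists h : forall n, hom X (cpow K n Y) -> hom X (cpow K n.+1 Y),
    (forall n x, cface K Y n 0 ∘ h n x = x) /\
    (forall n i x, cface K Y n.+1 i.+1 ∘ h n.+1 x = h n (cface K Y n i ∘ x)).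
Proof.
move=> /pobj_section [s es]; exists (fun n x => fmap K x ∘ s); split=> n *.
  by rewrite cface0 compA (natural (counit K)) -compA es compm1.
by rewrite cfaceS compA -fmapM.
Qed.

Lemma resolution_relatively_contractible Y :
  relatively_contractible P (augmented_resolution Y).
Proof.
move=> X /resolution_contraction -/(_ Y) [h [h0 hS]].
exists (h 0), (fun n => h n.+1); split=> [|n||n i _];
  apply: FunctionalExtensionality.functional_extensionality => x.
- exact: (h0 0).
- exact: (h0 n.+1).
- exact: (hS 0).
- exact: (hS n.+1).
Qed.

(** Coning off a sphere with the contraction [h] gives a horn that lacks only face 0, and face 0 of
    a filler of this horn fills the sphere. In the lowest degree [h] itself lifts. *)
Lemma resolution_fills_spheres X Y :
  Kan_projective_class P -> pobj P X -> fills_spheres (cface K Y) X.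
Proof.
move=> kanP pX.
have kan := kanP _ (resolution_relatively_contractible Y) X pX.
have [h [h0 hS]] := resolution_contraction Y pX.
case=> [|n] a Ha.
  by exists (h 0 (a 0)) => i le_i0; have -> : i = 0 by lia.
have [//||x Hx] := kan n.+1 0 _ (fun i => h n.+1 (a i.-1)).
  move=> [|i] [|j] lt_ij ni nj; try (exfalso; lia).
  have := hS n i (a j); have := hS n j.-1 (a i).
  rewrite -Ha; last by lia.
  case: j lt_ij {nj} => [|j] lt_ij; first by lia.
  by move=> e1 e2; apply: etrans e2 (esym e1).
exists (cface K Y n.+2 0 ∘ x) => i le_in.
rewrite compA -(cface_cface Y (i := 0) (j := i.+1)); last by lia.
have -> : a i = cface K Y n.+1 0 ∘ h n.+1 (a i) by rewrite h0.
by rewrite -compA; congr (_ ∘ _); apply: (Hx i.+1); lia.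
Qed.

End Resolution.

(** * Joint epimorphy of a section and a kernel *)

Section Homotopy.
Context (A : category) (hA : semi_abelian A).
Implicit Types S U V : simplicial A.

(** Pull back the graphs of [a] and [b] along each other. *)
Lemma equalizer_exists (X Y : A) (a b : hom X Y) :
  exists (Q : A) (m : hom Q X), [/\ monic m, a ∘ m = b ∘ m &
    forall T (h : hom T X), a ∘ h = b ∘ h -> exists t, m ∘ t = h].
Proof.
have [XY [p [q HXY]]] := product_exists hA X Y.
have [a' [[pa qa] _]] := HXY _ (idm X) a.
have [b' [[pb qb] _]] := HXY _ (idm X) b.
have [Q [m [m' HQ]]] :=
  regular_pullback (exact_regular (sa_exact hA)) a' b'.
have em : m = m'.
  by rewrite -[m]comp1m -pa -compA HQ.1 compA pb comp1m.
subst m'; exists Q, m; split=> [T s t e||T h e].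
- exact: (pullback_mono HQ).
- by rewrite -qa -compA HQ.1 compA qb.
- have [|t [[t1 _] _]] := HQ.2 T h h; last by exists t.
  have [x [_ Ux]] := HXY _ h (a ∘ h).
  rewrite -(Ux (a' ∘ h)) ?(Ux (b' ∘ h)) //.
    by rewrite !compA pb qb comp1m.
  by rewrite !compA pa qa comp1m.
Qed.

(** The equalizer of [a] and [b] contains both the section and the kernel, so by protomodularity it
    is all of [W]. *)
Lemma section_kernel_epi (W V N T : A) (r : hom W V) (t : hom V W)
    (k : hom N W) (a b : hom W T) :
  r ∘ t = idm V -> is_kernel r k -> a ∘ t = b ∘ t -> a ∘ k = b ∘ k -> a = b.
Proof.
move=> rt Hk et ek; have [Q [m [mono_m em fac]]] := equalizer_exists a b.
have [t' Ht] := fac _ _ et; have [k' Hk'] := fac _ _ ek.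
have [mi [_ mmi]] := split_subobject_iso hA mono_m rt Hk Ht Hk'.
by rewrite -[a]compm1 -[b]compm1 -mmi !compA em.
Qed.

(** * Cycles and their homology classes *)

Definition cycle_in S n : hom (odom (cycles hA S n)) (S n) :=
  moore_in hA S n ∘ oarr (cycles hA S n).

Definition class S n : hom (odom (cycles hA S n)) (homology_ob hA n S) :=
  uarr (homology_quotient hA S n).

Lemma cycle_in_mono S n : monic (cycle_in S n).
Proof.
move=> T s t; rewrite /cycle_in -!compA => /moore_mono.
exact: (kernel_mono (kernelP hA _)).
Qed.

Definition is_cycle S n T : hom T (S n) -> Prop :=
  match n return hom T (S n) -> Prop with
  | 0 => fun _ => True
  | m.+1 => fun h => forall i, i <= m.+1 -> is_zero_mor (face S m i ∘ h)
  end.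

(** All faces but the last vanish on the Moore object, and the last one restricts to the
    differential. *)
Lemma cycle_inP S n T (h : hom T (S n)) :
  (exists t, cycle_in S n ∘ t = h) <-> is_cycle h.
Proof.
case: n h => [|n] h /=; last split=> [[t <-] i le_in|zh].
- split=> // _; have [|t e] := @kernel_factor _ hA _ _ (moore_d hA S 0) _ h.
    exact: zero_mor_to (zero_objectP hA).
  by exists t; rewrite /cycle_in -compA e /moore_in /= comp1m.
- rewrite /cycle_in !compA; apply: zero_mor_l.
  case: (leqP i n) => [lt_in|lt_ni].
    exact/zero_mor_l/moore_face_zero.
  have -> : i = n.+1 by lia.
  rewrite -moore_dS -compA; apply: zero_mor_r.
  exact: (kernelP hA (moore_d hA S n.+1)).1.
- have [t et] : exists t, moore_in hA S n.+1 ∘ t = h.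
    by apply/moore_factorS => i le_in; apply: zh; lia.
  have [|u eu] := @kernel_factor _ hA _ _ (moore_d hA S n.+1) _ t.
    apply: (zero_mor_mono hA (@moore_mono _ hA S n)).
    by rewrite compA moore_dS -compA et; apply: zh.
  by exists u; rewrite /cycle_in -compA eu.
Qed.

Lemma class_boundary S n T (w : hom T (S n.+1))
    (z : hom T (odom (cycles hA S n))) :
  (forall i, i <= n -> is_zero_mor (face S n i ∘ w)) ->
  cycle_in S n ∘ z = face S n n.+1 ∘ w -> is_zero_mor (class S n ∘ z).
Proof.
move=> /(moore_factorS hA) [w' <-] ez.
have -> : z = boundary hA S n ∘ w'.
  apply: cycle_in_mono; rewrite ez !compA; congr (_ ∘ _).
  by rewrite /cycle_in -compA factorP moore_dS.
rewrite compA; apply: zero_mor_l.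
exact: (cokernelP hA (boundary hA S n)).1.
Qed.

Lemma degen_cycle_face S n j T (z : hom T (S n)) i :
  is_cycle z -> j <= n -> i <= n.+1 -> i <> j -> i <> j.+1 ->
  is_zero_mor (face S n i ∘ (degen S n j ∘ z)).
Proof.
case: n z => [|n] z Hz le_jn le_in ij ij1; first by lia.
rewrite compA; case: (ltngtP i j) => [lt_ij|lt_ji|//].
  rewrite face_degen_lt; last by lia.
  by rewrite -compA; apply/zero_mor_r/Hz; lia.
rewrite face_degen_gt; last by lia.
by rewrite -compA; apply/zero_mor_r/Hz; lia.
Qed.

(** Let [M] be the universal [w] with face [j] a cycle [d] and all faces but [j] and [j.+1] zero.
    The degeneracy of index [j] splits [d], and on it both faces agree. On the kernel of [d] both
    classes vanish, that of face [j.+1] by the hypothesis. Section and kernel are jointly epic, so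
    the classes agree on [M]. *)
Lemma class_adjacent S n j :
  j <= n ->
  (forall T (w : hom T (S n.+1)) (z : hom T (odom (cycles hA S n))),
    (forall i, i <= n.+1 -> i <> j.+1 -> is_zero_mor (face S n i ∘ w)) ->
    cycle_in S n ∘ z = face S n j.+1 ∘ w -> is_zero_mor (class S n ∘ z)) ->
  forall T (w : hom T (S n.+1)) (z z' : hom T (odom (cycles hA S n))),
    (forall i, i <= n.+1 -> i <> j -> i <> j.+1 ->
       is_zero_mor (face S n i ∘ w)) ->
    cycle_in S n ∘ z = face S n j ∘ w ->
    cycle_in S n ∘ z' = face S n j.+1 ∘ w -> class S n ∘ z = class S n ∘ z'.
Proof.
move=> le_jn IH.
(* A zero morphism in positions [j] and [j.+1] imposes no condition there. *)
pose f i := if (i == j) || (i == j.+1) then zero_mor hA (S n.+1) (S n)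
  else face S n i.
pose W := kernels_meet hA f n.+2.
have WP T (w : hom T (S n.+1)) : (exists t, oarr W ∘ t = w) <->
    (forall i, i <= n.+1 -> i <> j -> i <> j.+1 -> is_zero_mor (face S n i ∘ w)).
  apply: (iff_trans (kernels_meetP hA f n.+2 w)); split=> H i le_in.
    move=> /eqP ij /eqP ij1.
    by have := H i le_in; rewrite /f (negPf ij) (negPf ij1).
  rewrite /f; case: ifP => [_|/norP [/eqP ij /eqP ij1]]; last exact: H.
  apply: zero_mor_l; rewrite /zero_mor.
  by case: constructive_indefinite_description.
have zW : forall i, i <= n.+1 -> i <> j -> i <> j.+1 ->
    is_zero_mor (face S n i ∘ oarr W).
  by apply/WP; exists (idm _); rewrite compm1.
(* On [W], face [j] of face [j] need not vanish; the pullback forces face [j] to be a cycle. *)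
have [M [p [d HM]]] := regular_pullback (exact_regular (sa_exact hA))
  (face S n j ∘ oarr W) (cycle_in S n).
pose m := oarr W ∘ p.
have ed : cycle_in S n ∘ d = face S n j ∘ m by rewrite compA -HM.1.
have zm i : i <= n.+1 -> i <> j -> i <> j.+1 -> is_zero_mor (face S n i ∘ m).
  by move=> *; rewrite compA; apply: zero_mor_l; apply: zW.
have mono_m : monic m.
  move=> T s t; rewrite -!compA => /kernels_meet_mono e.
  apply: (pullback_mono HM) => //; apply: cycle_in_mono.
  by rewrite !compA ed -!compA e.
have fac T (w : hom T (S n.+1)) (z : hom T (odom (cycles hA S n))) :
    (forall i, i <= n.+1 -> i <> j -> i <> j.+1 ->
       is_zero_mor (face S n i ∘ w)) ->
    cycle_in S n ∘ z = face S n j ∘ w -> exists t, m ∘ t = w /\ d ∘ t = z.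
  move=> /WP [t0 <-] ez; have [|t [[t1 t2] _]] := HM.2 T t0 z.
    by rewrite -compA ez.
  by exists t; split=> //; rewrite -compA t1.
(* Face [j.+1] is then a cycle too: its own face [j] equals that of [d], and its other faces pass
   through vanishing faces of [m]. *)
have [c ec] : exists c, cycle_in S n ∘ c = face S n j.+1 ∘ m.
  apply/cycle_inP.
  have : is_cycle (face S n j ∘ m) by apply/cycle_inP; exists d.
  case: (n) m zm {ed mono_m fac} le_jn => // k m' zm' le_jk Hj i le_ik /=.
  rewrite compA; case: (ltngtP i j) => [lt_ij|lt_ji|eij].
  - rewrite face_face; last by lia.
    by rewrite -compA; apply/zero_mor_r/zm'; lia.
  - rewrite -(face_face S (i := j.+1) (j := i.+1)); last by lia.
    by rewrite -compA; apply/zero_mor_r/zm'; lia.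
  - rewrite face_face; last by lia.
    by rewrite -compA eij; apply: Hj; lia.
have [e [me de]] : exists e, m ∘ e = degen S n j ∘ cycle_in S n /\ d ∘ e = idm _.
  apply: fac; last by rewrite compA face_degen_eq // comp1m compm1.
  move=> *; apply: degen_cycle_face => //.
  by apply/cycle_inP; exists (idm _); rewrite compm1.
have dc : class S n ∘ d = class S n ∘ c.
  have [N [k Hk]] := kernel_exists hA d.
  apply: (section_kernel_epi de Hk).
    rewrite -!compA de; congr (_ ∘ _); apply: cycle_in_mono.
    by rewrite compA ec -compA me compA face_degen_eqS // comp1m compm1.
  apply: zero_mor_uniq.
    by rewrite -compA; apply/zero_mor_r/Hk.1.
  rewrite -compA; apply: (IH _ (m ∘ k)); last by rewrite compA ec compA.
  move=> i le_in ij1; have [->|/eqP ij] := eqVneq i j.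
    by rewrite compA -ed -compA; apply/zero_mor_r/Hk.1.
  by rewrite compA; apply/zero_mor_l/zm.
move=> T w z z' zw ez ez'; have [t [mt dt]] := fac _ _ _ zw ez.
have -> : z' = c ∘ t by apply: cycle_in_mono; rewrite ez' compA ec -compA mt.
by rewrite -dt !compA dc.
Qed.

(** Descending induction on [j]: at [j = n.+1] the cycle is a Moore boundary; below,
    [class_adjacent] compares face [j] with face [j.+1], which is zero here. *)
Lemma class_face_zero S n j T (w : hom T (S n.+1))
    (z : hom T (odom (cycles hA S n))) :
  j <= n.+1 ->
  (forall i, i <= n.+1 -> i <> j -> is_zero_mor (face S n i ∘ w)) ->
  cycle_in S n ∘ z = face S n j ∘ w -> is_zero_mor (class S n ∘ z).
Proof.
move=> le_jn; move: {2}(n.+1 - j) (leqnn (n.+1 - j)) => m le_m.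
elim: m j T w z le_m le_jn => [|m IH] j T w z le_m le_jn zw ez.
  have ej : j = n.+1 by lia.
  by rewrite ej in zw ez; apply: (class_boundary (w := w)) ez => i le_in;
     apply: zw; lia.
have [ej|lt_jn] : j = n.+1 \/ j <= n by lia.
  by apply: (IH j _ w) => //; lia.
have [z0 Hz0] := zero_mor_exists hA T (odom (cycles hA S n)).
have -> : class S n ∘ z = class S n ∘ z0; last exact: zero_mor_r.
apply: (@class_adjacent S n j lt_jn _ T w) => //.
- by move=> T1 w1 z1; apply: IH; lia.
- by move=> i le_in ij _; apply: zw.
- apply: zero_mor_uniq; first exact: zero_mor_r.
  by apply: zw; lia.
Qed.

(** * Morphisms induced on homology and their homotopy invariance *)

(* Only compatibility with the faces is required of [s], whereas
   [homology_map] is defined for simplicial morphisms. *)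
Definition induces S U n (s : hom (S n) (U n))
    (t : hom (homology_ob hA n S) (homology_ob hA n U)) : Prop :=
  exists z, cycle_in U n ∘ z = s ∘ cycle_in S n /\
    t ∘ class S n = class U n ∘ z.

Lemma induces_uniq S U n (s : hom (S n) (U n)) t t' :
  induces s t -> induces s t' -> t = t'.
Proof.
move=> [z [ez et]] [z' [ez' et']].
apply: (cokernel_epi (cokernelP hA (boundary hA S n))).
rewrite -/(class S n) et et'; congr (_ ∘ _).
by apply: cycle_in_mono; rewrite ez ez'.
Qed.

Lemma induces_id S n : induces (idm (S n)) (idm (homology_ob hA n S)).
Proof. by exists (idm _); rewrite !compm1 !comp1m. Qed.

Lemma induces_comp S U V n (s : hom (S n) (U n)) (r : hom (U n) (V n)) t u :
  induces s t -> induces r u -> induces (r ∘ s) (u ∘ t).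
Proof.
move=> [z [ez et]] [y [ey eu]]; exists (y ∘ z); split.
  by rewrite compA ey -compA ez compA.
by rewrite -compA et compA eu compA.
Qed.

Lemma homology_map_induces S U (s : smor S U) n :
  induces (s n) (homology_map hA n s).
Proof.
exists (cycles_map hA s n); rewrite /class homology_mapE; split=> //.
by rewrite /cycle_in -compA cycles_mapE compA moore_mapE compA.
Qed.

Lemma induced_exists S U (s : forall n, hom (S n) (U n)) n :
  (forall n i, i <= n.+1 -> face U n i ∘ s n.+1 = s n ∘ face S n i) ->
  exists t, induces (s n) t.
Proof.
move=> Hs.
have cyc T (h : hom T (S n)) : is_cycle h -> is_cycle (s n ∘ h).
  case: n h => //= m h Hh i le_im.
  by rewrite compA Hs // -compA; apply/zero_mor_r/Hh.
have [|z ez] := proj2 (cycle_inP (s n ∘ cycle_in S n)).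
  by apply/cyc/cycle_inP; exists (idm _); rewrite compm1.
have [|t [et _]] := (cokernelP hA (boundary hA S n)).2 _ (class U n ∘ z).
  rewrite -compA.
  apply: (class_boundary (w := s n.+1 ∘ moore_in hA S n.+1)) => [i le_in|].
    rewrite compA Hs; last by lia.
    by rewrite -compA; apply/zero_mor_r/moore_face_zero.
  rewrite compA ez -compA [_ ∘ boundary _ _ _](_ : _ = face S n n.+1 ∘
    moore_in hA S n.+1); first by rewrite !compA Hs.
  by rewrite /cycle_in -compA factorP moore_dS.
by exists t, z.
Qed.

(** Prism argument: on a cycle [x], the values of [y n p] and [y n p.+1] are the faces [p] and
    [p.+1] of [y n.+1 p.+1 ∘ (degen S n p ∘ x)], whose other faces vanish. Hence their classes
    agree, and [p] runs from [f] at 0 to [g] at [n.+1]. *)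
Lemma homotopic_induced S U (f g : forall n, hom (S n) (U n))
    (y : forall n, nat -> hom (S n) (U n)) n t t' :
  (forall n, y n 0 = f n) -> (forall n, y n n.+1 = g n) ->
  (forall n p i, i <= n.+1 ->
    face U n i ∘ y n.+1 p = y n (interval_face i p) ∘ face S n i) ->
  induces (f n) t -> induces (g n) t' -> t = t'.
Proof.
move=> y0 yn Hy [zf [ef et]] [zg [eg et']].
apply: (cokernel_epi (cokernelP hA (boundary hA S n))).
rewrite -/(class S n) et et'.
have Hx : is_cycle (cycle_in S n).
  by apply/cycle_inP; exists (idm _); rewrite compm1.
suff cl p : p <= n.+1 -> forall z,
    cycle_in U n ∘ z = y n p ∘ cycle_in S n -> class U n ∘ zf = class U n ∘ z.
  by apply: (cl n.+1) => //; rewrite eg yn.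
elim: p => [_ z ez|p IH le_pn z ez].
  by congr (_ ∘ _); apply: cycle_in_mono; rewrite ef ez y0.
have [|zp ezp] := proj2 (cycle_inP (y n p ∘ cycle_in S n)).
  case: (n) (cycle_in S n) Hx => // m x Hx0 i le_im /=.
  by rewrite compA Hy // -compA; apply/zero_mor_r/Hx0.
rewrite (IH _ zp ezp); last by lia.
apply: (@class_adjacent U n p _ _ _
  (y n.+1 p.+1 ∘ (degen S n p ∘ cycle_in S n))).
- by lia.
- by move=> T w z1; apply: class_face_zero.
- move=> i le_in ip ip1; rewrite compA Hy // -compA; apply: zero_mor_r.
  exact: degen_cycle_face.
- rewrite compA Hy; last by lia.
  rewrite /interval_face ltnSn -compA [face _ _ _ ∘ _]compA.
  by rewrite face_degen_eq ?comp1m //; lia.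
- rewrite compA Hy; last by lia.
  rewrite /interval_face ltnn -compA [face _ _ _ ∘ _]compA.
  by rewrite face_degen_eqS ?comp1m //; lia.
Qed.

End Homotopy.

(** * Comparison of the homologies of two comonads *)

Section Comparison.
Context (C : category) (P : projective_class C).
Hypothesis kanP : Kan_projective_class P.
Context (A : category) (hA : semi_abelian A) (E : functor C A).

Definition lift_of (G K : comonad C) (X Y : C) (b : hom X Y)
    (f : forall n, hom (cpow G n X) (cpow K n Y)) : Prop :=
  f 0 = b /\ face_map (cface G X) (cface K Y) f.

Definition coresolution (G : comonad C) : functor C (simplicial_category A) :=
  compF (simplicial_map E) (resolution G).

(** A relation rather than a chosen morphism: once existence and uniqueness are known, naturality
    and invertibility reduce to its closure under composition. *)
Definition induced_over (G K : comonad C) (X Y : C) (b : hom X Y) n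
    (t : hom (homology_ob hA n (coresolution G X))
             (homology_ob hA n (coresolution K Y))) : Prop :=
  exists2 f, lift_of b f & induces
    (S := coresolution G X) (U := coresolution K Y) (fmap E (f n.+1)) t.

Lemma induced_over_exists (G K : comonad C) X Y (b : hom X Y) n :
  generates G P -> generates K P ->
  exists t, @induced_over G K X Y b n t.
Proof.
move=> genG genK.
have [|m|f Hf] := @lift_exists C (fun n => cpow G n X) (fun n => cpow K n Y)
  (cface G X) (cface K Y) _ _ b.
- exact: cface_cface.
- exact: resolution_fills_spheres genK _ _ kanP (pobj_cofree genG _).
have [|t Ht] := @induced_exists A hA (coresolution G X) (coresolution K Y)
  (fun n => fmap E (f n.+1)) n; last by exists t, f.
by move=> m i le_im; apply: fmap_square; apply: Hf.2.
Qed.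

Lemma induced_over_uniq (G K : comonad C) X Y (b : hom X Y) n t t' :
  generates G P -> generates K P ->
  @induced_over G K X Y b n t -> @induced_over G K X Y b n t' -> t = t'.
Proof.
move=> genG genK [f [f0 Hf] Ht] [g [g0 Hg] Ht'].
have [|m||y [y0 yn Hy]] := homotopy_exists _ _ Hf Hg; last 1 first.
- apply: (@homotopic_induced A hA (coresolution G X) (coresolution K Y)
    (fun n => fmap E (f n.+1)) (fun n => fmap E (g n.+1))
    (fun n p => fmap E (y n.+1 p)) n t t') => // [m|m|m p i le_im].
  + by rewrite y0.
  + by rewrite yn.
  + by apply: fmap_square; apply: Hy.
- exact: cface_cface.
- exact: resolution_fills_spheres genK _ _ kanP (pobj_cofree genG _).
- by rewrite f0 g0.
Qed.

Lemma induced_over_comp (G K L : comonad C) X Y Z (b : hom X Y) (c : hom Y Z)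
    n t u :
  @induced_over G K X Y b n t -> @induced_over K L Y Z c n u ->
  @induced_over G L X Z (c ∘ b) n (u ∘ t).
Proof.
move=> [f [f0 Hf] Ht] [g [g0 Hg] Hu]; exists (fun n => g n ∘ f n).
  split=> [|m i le_im]; first by rewrite f0 g0.
  by rewrite compA Hg // -compA Hf // compA.
by rewrite fmapM; apply: induces_comp Ht Hu.
Qed.

Lemma induced_over_map (G : comonad C) X Y (b : hom X Y) n :
  @induced_over G G X Y b n (homology_map hA n (fmap (coresolution G) b)).
Proof.
exists (fun n => cpow_map G n b); last first.
  exact: (homology_map_induces hA (fmap (coresolution G) b) n).
by split=> // m i; apply: cpow_map_cface.
Qed.

Lemma induced_over_id (G : comonad C) X n :
  @induced_over G G X X (idm X) n (idm _).
Proof.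
by have := induced_over_map G (idm X) n; rewrite fmap1 homology_map_id.
Qed.

End Comparison.

Theorem theorem4p11 (C : category) (G K : comonad C) (P : projective_class C)
    (genG : generates G P) (genK : generates K P)
    (kanP : Kan_projective_class P)
    (A : category) (hA : semi_abelian A) (E : functor C A) (n : nat)
    (n_ge1 : 1 <= n) :
  naturally_isomorphic (comonad_homology hA G E n) (comonad_homology hA K E n).
Proof.
have ex X := induced_over_exists kanP hA E (idm X) n.-1 genG genK.
pose t X := proj1_sig (constructive_indefinite_description _ (ex X)).
have Ht X : induced_over (idm X) (t X) :=
  proj2_sig (constructive_indefinite_description _ (ex X)).
have nat_t X Y (f : hom X Y) :
    t Y ∘ fmap (comonad_homology hA G E n) f =
    fmap (comonad_homology hA K E n) f ∘ t X.
  (* Both composites are induced over [f], hence equal. *)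
  apply: (induced_over_uniq kanP genG genK (b := f)).
    have := induced_over_comp (induced_over_map hA E G f n.-1) (Ht Y).
    by rewrite comp1m.
  have := induced_over_comp (Ht X) (induced_over_map hA E K f n.-1).
  by rewrite compm1.
exists (@NatTrans _ _ (comonad_homology hA G E n) (comonad_homology hA K E n)
  t nat_t) => X.
(* The inverse is the comparison in the opposite direction; both composites and the identities are
   induced over [idm X]. *)
have [u Hu] := induced_over_exists kanP hA E (idm X) n.-1 genK genG.
exists u; split.
  apply: (induced_over_uniq kanP genG genG _ (induced_over_id _ _ _ _ _)).
  by have := induced_over_comp (Ht X) Hu; rewrite comp1m.
apply: (induced_over_uniq kanP genK genK _ (induced_over_id _ _ _ _ _)).
by have := induced_over_comp Hu (Ht X); rewrite comp1m.
Qed.
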